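(* Let $L/k$ be a finite Galois extension with Galois group $G$, let $n\geq 1$, and let $C$ be an $L$-linear subspace of $L^n$. Then the Galois closure of $C$ is equal to the intersection of all $L$-linear subspaces of $L^n$ that are extended from $k^n$ and contain $C$.
   Context: For a finite Galois extension $L/k$ with group $G$, the Galois closure of an $L$-linear subspace $C$ of $L^n$ is the smallest $L$-linear subspace of $L^n$ that contains $C$ and is invariant under the component-wise action of $G$ on $L^n$. An $L$-linear subspace of $L^n$ is extended from $k^n$ if it is spanned over $L$ by vectors in $k^n$. *)

(* Defs.v *)
From HB Require Import structures.
From mathcomp Require Import all_boot all_order all_algebra all_fingroup all_field.
From mathcomp Require Import boolp classical_sets.

Set Implicit Arguments.
Unset Strict Implicit.
Unset Printing Implicit Defensive.

Import GRing.Theory.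
Local Open Scope ring_scope.

Section GaloisClosure.
Variables (k : fieldType) (L : splittingFieldType k) (n : nat).
Implicit Types C D E : {vspace 'rV[L]_n}.

(* Inclusion suffices: 'Gal({:L} / 1) is a group, so D is then mapped onto
   itself by each g. *)
Definition galois_invariant D : Prop :=
  forall g : gal_of {:L}%AS, (g \in 'Gal({:L} / 1))%g -> forall v, v \in D -> map_mx g v \in D.

(* k^n sits in L^n through the structural embedding in_alg L : c |-> c%:A; a
   finite spanning family is no restriction since L^n is finite-dimensional. *)
Definition extended_from_base D : Prop :=
  exists s : seq 'rV[k]_n, D = <<[seq map_mx (in_alg L) v | v <- s]>>%VS.

Definition is_galois_closure C D : Prop :=
  [/\ (C <= D)%VS, galois_invariant D &
      forall E, (C <= E)%VS -> galois_invariant E -> (D <= E)%VS].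

Lemma galois_closure_exists C : exists D, is_galois_closure C D.
Proof.
pose P m := `[< exists D, [/\ (C <= D)%VS, galois_invariant D & \dim D = m] >].
have exP : exists m, P m.
  exists (\dim {: 'rV[L]_n}); apply/asboolP; exists fullv; split=> //.
    exact: subvf.
  by move=> g _ v _; exact: memvf.
case: (ex_minnP exP) => m /asboolP[D [CD invD dimD]] minD.
exists D; split=> // E CE invE; apply/capv_idPl/eqP.
rewrite eqEdim capvSl dimD; apply: minD; apply/asboolP.
exists (D :&: E)%VS; split=> //; first by rewrite subv_cap CD.
move=> g gG v; rewrite !memv_cap => /andP[vD vE].
by rewrite invD // invE.
Qed.

Definition galois_closure C : {vspace 'rV[L]_n} :=
  sval (cid (galois_closure_exists C)).

Lemma galois_closureP C : is_galois_closure C (galois_closure C).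
Proof. exact: svalP (cid (galois_closure_exists C)). Qed.

Lemma is_galois_closure_uniq C D D' :
  is_galois_closure C D -> is_galois_closure C D' -> D = D'.
Proof.
move=> [CD invD minD] [CD' invD' minD'].
by apply/eqP; rewrite eqEsubv minD ?minD'.
Qed.

End GaloisClosure.

(* Main.v *)
(* An L-subspace of L^n is extended from k^n if and only if it is
   Galois-invariant, so both sides are the least such subspace containing C.
   The nontrivial direction is descent by traces: by independence of
   automorphisms there are w_j, c_j in L with \sum_j g(w_j) c_j = [g = 1] for
   all g in G, whence v = \sum_j c_j Tr(w_j v), where Tr(w_j v) lies in k^n and
   in every invariant subspace containing v. *)
Require Import Defs.
From mathcomp Require Import all_boot all_order all_algebra all_fingroup all_field.
From mathcomp Require Import boolp classical_sets.

Import GRing.Theory.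

Section Descent.
Local Open Scope ring_scope.
Context {k : fieldType} {L : splittingFieldType k} {n : nat}.
Implicit Types (C D E : {vspace 'rV[L]_n}) (v : 'rV[L]_n).

Local Notation G := 'Gal({:L} / 1)%g.

Lemma gal_dual_family :
  exists w c : 'I_#|G| -> L,
    forall g, g \in G -> \sum_j g (w j) * c j = (g == 1%g)%:R.
Proof.
have [w _ [unitM _ _]] := gal_matrix G.
set M := \matrix_(i, j) _ in unitM.
pose i1 := enum_rank_in (group1 G) 1%g.
(* [c] is the column of [invmx M] at the identity, so the claim is that column of
   [M *m invmx M = 1]. *)
exists (tnth w), (fun j => invmx M j i1) => g gG.
have /matrixP/(_ (enum_rank_in (group1 G) g) i1) := mulmxV unitM.
rewrite !mxE (can_in_eq (enum_rankK_in _)) ?group1 // => <-.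
by apply: eq_bigr => j _; rewrite !mxE enum_rankK_in.
Qed.

Definition rV_galTrace v := \sum_(g in G) map_mx g v.

(** Each coordinate is a field trace, which the Galois hypothesis places in [1%AS], the line of
    scalars [a%:A]. *)
Lemma rV_galTrace_base v :
  galois 1%AS {:L}%AS ->
  exists u : 'rV[k]_n, map_mx (in_alg L) u = rV_galTrace v.
Proof.
move=> galL.
have /choice[f fE] j : exists a : k, a%:A = galTrace 1%AS {:L}%AS (v 0 j).
  by have /vlineP[a ->] := mem_galTrace galL (memvf (v 0 j)); exists a.
exists (\row_j f j); apply/rowP=> j.
by rewrite !mxE /= fE summxE; apply: eq_bigr => g _; rewrite mxE.
Qed.

Lemma mem_rV_galTrace D v : galois_invariant D -> v \in D -> rV_galTrace v \in D.
Proof. by move=> invD vD; apply: rpred_sum => g gG; apply: invD. Qed.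

Lemma galois_invariant_extended D :
  galois 1%AS {:L}%AS -> galois_invariant D -> extended_from_base D.
Proof.
move=> galL invD.
have /choice[tr trE] v := rV_galTrace_base v galL.
have [w [c wc]] := gal_dual_family.
exists [seq tr (w j *: v) | v <- vbasis D, j <- enum 'I_#|G|].
apply/eqP; rewrite eqEsubv; apply/andP; split; last first.
  apply/span_subvP=> _ /mapP[_ /allpairsP[[v j] /= [vD _ ->]] ->].
  by rewrite trE mem_rV_galTrace // memvZ // vbasis_mem.
rewrite -{1}(span_basis (vbasisP D)); apply/span_subvP=> v vD.
have ->: v = \sum_j c j *: map_mx (in_alg L) (tr (w j *: v)).
  under eq_bigr => j _ do rewrite trE /rV_galTrace scaler_sumr.
  (* After the exchange, [map_mx g v] has coefficient [\sum_j g (w j) * c j], which vanishes unless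
     [g] is the identity. *)
  rewrite exchange_big /= (bigD1 1%g) ?group1 //= [X in _ + X]big1 => [|g].
    under eq_bigr => j _ do rewrite map_mxZ scalerA mulrC.
    rewrite -scaler_suml wc // eqxx scale1r addr0.
    by apply/rowP=> j; rewrite mxE /= gal_id.
  case/andP=> gG /negPf g1.
  under eq_bigr => j _ do rewrite map_mxZ scalerA mulrC.
  by rewrite -scaler_suml wc // g1 scale0r.
apply: rpred_sum => j _; apply/memvZ/memv_span/map_f.
by apply/allpairsP; exists (v, j); rewrite mem_enum.
Qed.

(** Each [g] acts semilinearly and fixes the image of [k], so it only changes the coefficients of a
    combination of base vectors. *)
Lemma extended_galois_invariant D : extended_from_base D -> galois_invariant D.
Proof.
move=> [s ->] g gG v /(@coord_span _ _ _ (in_tuple _)) ->.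
rewrite raddf_sum; apply: rpred_sum => i _ /=; rewrite map_mxZ; apply: memvZ.
have /mapP[u us ->] := mem_nth 0 (ltn_ord i).
rewrite -map_mx_comp (_ : map_mx _ u = map_mx (in_alg L) u).
  exact/memv_span/map_f.
apply/rowP=> j; rewrite !mxE /=.
by rewrite (fixed_gal (sub1v _) gG) // rpredZ ?mem1v.
Qed.

End Descent.

Local Open Scope classical_set_scope.

Theorem corollary4p3 (k : fieldType) (L : splittingFieldType k)
    (galL : galois 1%AS {:L}%AS) (n : nat) (n_ge1 : (1 <= n)%N)
    (C : {vspace 'rV[L]_n}) :
  [set` galois_closure C] =
  \bigcap_(E in [set E : {vspace 'rV[L]_n} |
                 extended_from_base E /\ (C <= E)%VS]) [set` E].
Proof.
have [CD invD minD] := galois_closureP C.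
apply/seteqP; split=> [v /= vD E [/extended_galois_invariant invE CE] | v vE].
  exact: (subvP (minD E CE invE)).
(* Conversely, the closure is itself one of the subspaces being intersected. *)
by apply: vE; split=> //; apply: galois_invariant_extended.
Qed.
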